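(* Assume $q$ is not a root of unity. For every $d\in\mathbb N$, up to isomorphism there exists a unique irreducible $\mathcal A$-module of dimension $d+1$.
   Context: $\mathbb K$ is a field and $q$ is a nonzero scalar in $\mathbb K$ that is not a root of unity (in particular $q^2\ne1$). $\mathbb N=\{0,1,2,\ldots\}$. Dimension is over $\mathbb K$. $U_q(\mathfrak{sl}_2)$ is the unital associative $\mathbb K$-algebra with generators $x,y,y^{-1},z$ and relations $yy^{-1}=y^{-1}y=1$, $\frac{qxy-q^{-1}yx}{q-q^{-1}}=1$, $\frac{qyz-q^{-1}zy}{q-q^{-1}}=1$, $\frac{qzx-q^{-1}xz}{q-q^{-1}}=1$. $\mathcal A$ is the $\mathbb K$-subalgebra of $U_q(\mathfrak{sl}_2)$ spanned by $x^ry^sz^t$ with $r,s,t\in\mathbb N$ and $r+s+t$ even. *)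

(* Defs.v *)
From HB Require Import structures.
From mathcomp Require Import all_boot all_order all_algebra.
From mathcomp Require Import boolp.

Set Implicit Arguments.
Unset Strict Implicit.
Unset Printing Implicit Defensive.

Import GRing.Theory.

Local Open Scope ring_scope.
Local Open Scope quotient_scope.

Definition not_root_of_unity (K : fieldType) (q : K) : Prop :=
  forall n : nat, (0 < n)%N -> q ^+ n != 1.

(* U_q(sl_2) by generators and relations: noncommutative polynomial
   expressions in the four generators, modulo the least congruence that
   contains the axioms of unital associative K-algebras and the defining
   relations. *)

Inductive Uq_gen : Type := gen_x | gen_y | gen_yinv | gen_z.

Inductive Uq_term (K : fieldType) : Type :=
| tScal of K
| tGen of Uq_gen
| tAdd of Uq_term K & Uq_term K
| tMul of Uq_term K & Uq_term K.

Arguments tGen {K}.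

HB.instance Definition _ (K : fieldType) := gen_eqMixin (Uq_term K).
HB.instance Definition _ (K : fieldType) := gen_choiceMixin (Uq_term K).

Definition tScale (K : fieldType) (a : K) (t : Uq_term K) : Uq_term K :=
  tMul (tScal a) t.

Definition tOpp (K : fieldType) (t : Uq_term K) : Uq_term K := tScale (- 1) t.

(* (q u v - q^-1 v u) / (q - q^-1) *)
Definition tqcomm (K : fieldType) (q : K) (u v : Uq_term K) : Uq_term K :=
  tScale (q - q^-1)^-1
    (tAdd (tScale q (tMul u v)) (tOpp (tScale q^-1 (tMul v u)))).

Inductive Uq_rel (K : fieldType) (q : K) : Uq_term K -> Uq_term K -> Prop :=
| rel_yyinv : Uq_rel q (tMul (tGen gen_y) (tGen gen_yinv)) (tScal 1)
| rel_yinvy : Uq_rel q (tMul (tGen gen_yinv) (tGen gen_y)) (tScal 1)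
| rel_xy : Uq_rel q (tqcomm q (tGen gen_x) (tGen gen_y)) (tScal 1)
| rel_yz : Uq_rel q (tqcomm q (tGen gen_y) (tGen gen_z)) (tScal 1)
| rel_zx : Uq_rel q (tqcomm q (tGen gen_z) (tGen gen_x)) (tScal 1).

Inductive Uq_cong (K : fieldType) (q : K) : Uq_term K -> Uq_term K -> Prop :=
| cong_refl t : Uq_cong q t t
| cong_sym t u : Uq_cong q t u -> Uq_cong q u t
| cong_trans t u v : Uq_cong q t u -> Uq_cong q u v -> Uq_cong q t v
| cong_add t t' u u' : Uq_cong q t t' -> Uq_cong q u u' ->
    Uq_cong q (tAdd t u) (tAdd t' u')
| cong_mul t t' u u' : Uq_cong q t t' -> Uq_cong q u u' ->
    Uq_cong q (tMul t u) (tMul t' u')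
| cong_addA t u v : Uq_cong q (tAdd t (tAdd u v)) (tAdd (tAdd t u) v)
| cong_addC t u : Uq_cong q (tAdd t u) (tAdd u t)
| cong_add0 t : Uq_cong q (tAdd (tScal 0) t) t
| cong_addN t : Uq_cong q (tAdd (tOpp t) t) (tScal 0)
| cong_mulA t u v : Uq_cong q (tMul t (tMul u v)) (tMul (tMul t u) v)
| cong_mul1l t : Uq_cong q (tMul (tScal 1) t) t
| cong_mul1r t : Uq_cong q (tMul t (tScal 1)) t
| cong_mulDl t u v : Uq_cong q (tMul (tAdd t u) v) (tAdd (tMul t v) (tMul u v))
| cong_mulDr t u v : Uq_cong q (tMul t (tAdd u v)) (tAdd (tMul t u) (tMul t v))
| cong_scalD a b : Uq_cong q (tScal (a + b)) (tAdd (tScal a) (tScal b))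
| cong_scalM a b : Uq_cong q (tScal (a * b)) (tMul (tScal a) (tScal b))
| cong_scalC a t : Uq_cong q (tMul (tScal a) t) (tMul t (tScal a))
| cong_rel t u : Uq_rel q t u -> Uq_cong q t u.

Section Evaluation.
Variables (K : fieldType) (q : K) (B : algType K) (g : Uq_gen -> B).

Fixpoint Uq_eval (t : Uq_term K) : B :=
  match t with
  | tScal a => a%:A
  | tGen i => g i
  | tAdd t u => Uq_eval t + Uq_eval u
  | tMul t u => Uq_eval t * Uq_eval u
  end.

Lemma Uq_eval_cong :
  (forall t u, Uq_rel q t u -> Uq_eval t = Uq_eval u) ->
  forall t u, Uq_cong q t u -> Uq_eval t = Uq_eval u.
Proof.
move=> gq t u; elim=> //=.
- by move=> ? ? ? _ -> _ ->.
- by move=> ? ? ? ? _ -> _ ->.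
- by move=> ? ? ? ? _ -> _ ->.
- by move=> *; rewrite addrA.
- by move=> *; rewrite addrC.
- by move=> *; rewrite scale0r add0r.
- by move=> *; rewrite mulr_algl scaleN1r addNr scale0r.
- by move=> *; rewrite mulrA.
- by move=> *; rewrite scale1r mul1r.
- by move=> *; rewrite scale1r mulr1.
- by move=> *; rewrite mulrDl.
- by move=> *; rewrite mulrDr.
- by move=> *; rewrite scalerDl.
- by move=> *; rewrite mulr_algl scalerA.
- by move=> *; rewrite mulr_algl mulr_algr.
Qed.

End Evaluation.

Section UqAlgebra.
Variables (K : fieldType) (q : K).

Definition Uq_congb : rel (Uq_term K) := fun t u => `[< Uq_cong q t u >].

Lemma Uq_congb_refl : reflexive Uq_congb.
Proof. by move=> t; apply/asboolP/cong_refl. Qed.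

Lemma Uq_congb_sym : symmetric Uq_congb.
Proof. by move=> t u; apply/asboolP/asboolP; apply: cong_sym. Qed.

Lemma Uq_congb_trans : transitive Uq_congb.
Proof.
by move=> u t v /asboolP tu /asboolP uv; apply/asboolP/(cong_trans tu uv).
Qed.

Canonical Uq_equiv := EquivRel Uq_congb Uq_congb_refl Uq_congb_sym Uq_congb_trans.

(* The hypotheses on q are parameters of the type because 1 <> 0, required by
   nzRingType, fails for q ^+ 2 = 1. *)
Definition Uq of q != 0 & not_root_of_unity q := {eq_quot Uq_congb}.

Variables (q_neq0 : q != 0) (q_nru : not_root_of_unity q).
Local Notation U := (Uq q_neq0 q_nru).

HB.instance Definition _ := Choice.on U.

Definition Uq_class (t : Uq_term K) : U := \pi_{eq_quot Uq_congb} t.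
Local Notation cl := Uq_class.

Lemma Uq_classP t u : cl t = cl u <-> Uq_cong q t u.
Proof. by split=> [/eqmodP/asboolP|h]; [|apply/eqmodP/asboolP]. Qed.

Lemma Uq_class_eq t u : Uq_cong q t u -> cl t = cl u.
Proof. by move/Uq_classP. Qed.

Lemma Uq_class_surj (u : U) : exists t, u = cl t.
Proof. by exists (repr (u : {eq_quot Uq_congb})); rewrite /Uq_class reprK. Qed.

Definition Uq_repr (u : U) : Uq_term K := repr (u : {eq_quot Uq_congb}).

Lemma Uq_repr_cong t : Uq_cong q (Uq_repr (cl t)) t.
Proof. by apply/Uq_classP; rewrite /Uq_class /Uq_repr reprK. Qed.

Definition Uq_add (u v : U) : U := cl (tAdd (Uq_repr u) (Uq_repr v)).
Definition Uq_mul (u v : U) : U := cl (tMul (Uq_repr u) (Uq_repr v)).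
Definition Uq_opp (u : U) : U := cl (tOpp (Uq_repr u)).
Definition Uq_scale (a : K) (u : U) : U := cl (tScale a (Uq_repr u)).

Lemma Uq_addE t u : Uq_add (cl t) (cl u) = cl (tAdd t u).
Proof. by apply/Uq_class_eq/cong_add; apply: Uq_repr_cong. Qed.

Lemma Uq_mulE t u : Uq_mul (cl t) (cl u) = cl (tMul t u).
Proof. by apply/Uq_class_eq/cong_mul; apply: Uq_repr_cong. Qed.

Lemma Uq_oppE t : Uq_opp (cl t) = cl (tOpp t).
Proof. by apply/Uq_class_eq/cong_mul; [apply: cong_refl|apply: Uq_repr_cong]. Qed.

Lemma Uq_scaleE a t : Uq_scale a (cl t) = cl (tScale a t).
Proof. by apply/Uq_class_eq/cong_mul; [apply: cong_refl|apply: Uq_repr_cong]. Qed.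

Local Ltac lift1 := let t := fresh in let H := fresh in
  move=> t; have [? H] := Uq_class_surj t; rewrite {t}H.
Local Ltac crush := rewrite ?(Uq_addE, Uq_mulE, Uq_oppE, Uq_scaleE);
  apply: Uq_class_eq; by constructor.

Lemma Uq_addA : associative Uq_add.
Proof. by do 3 lift1; crush. Qed.
Lemma Uq_addC : commutative Uq_add.
Proof. by do 2 lift1; crush. Qed.
Lemma Uq_add0 : left_id (cl (tScal 0)) Uq_add.
Proof. by lift1; crush. Qed.
Lemma Uq_addN : left_inverse (cl (tScal 0)) Uq_opp Uq_add.
Proof. by lift1; crush. Qed.

HB.instance Definition _ :=
  GRing.isZmodule.Build U Uq_addA Uq_addC Uq_add0 Uq_addN.

Lemma Uq_mulA : associative Uq_mul.
Proof. by do 3 lift1; crush. Qed.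
Lemma Uq_mul1l : left_id (cl (tScal 1)) Uq_mul.
Proof. by lift1; crush. Qed.
Lemma Uq_mul1r : right_id (cl (tScal 1)) Uq_mul.
Proof. by lift1; crush. Qed.
Lemma Uq_mulDl : left_distributive Uq_mul +%R.
Proof. by do 3 lift1; rewrite /GRing.add /=; crush. Qed.
Lemma Uq_mulDr : right_distributive Uq_mul +%R.
Proof. by do 3 lift1; rewrite /GRing.add /=; crush. Qed.

Lemma subr_inv_neq0 : q - q^-1 != 0.
Proof.
rewrite subr_eq0; apply/eqP => qV.
by have := q_nru (n := 2) isT; rewrite expr2 {2}qV mulfV // eqxx.
Qed.

Lemma Uq_oner_neq0 : cl (tScal 1) != 0.
Proof.
apply/eqP => /Uq_classP /(Uq_eval_cong (B := K^o) (g := fun=> 1)) /=.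
have q1 : 1 * ((q - q^-1)^-1 * (q - q^-1)) = 1 :> K.
  by rewrite mul1r mulVf ?subr_inv_neq0.
move=> h; have/h/eqP : forall t u, Uq_rel q t u ->
    Uq_eval (fun=> 1 : K^o) t = Uq_eval (fun=> 1) u.
  move=> t u [] /=; rewrite ?mulr1 ?scale1r // /GRing.scale /= !mulr1 mulN1r;
  by rewrite mulVf ?subr_inv_neq0.
by rewrite scale1r scale0r oner_eq0.
Qed.

HB.instance Definition _ := GRing.Zmodule_isNzRing.Build U
  Uq_mulA Uq_mul1l Uq_mul1r Uq_mulDl Uq_mulDr Uq_oner_neq0.

Lemma Uq_scaleA a b u : Uq_scale a (Uq_scale b u) = Uq_scale (a * b) u.
Proof.
move: u; lift1; rewrite !Uq_scaleE; apply: Uq_class_eq.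
apply: cong_trans (cong_mulA _ _ _ _) _.
by apply: cong_mul (cong_refl _ _); apply/cong_sym/cong_scalM.
Qed.
Lemma Uq_scale1 : left_id 1 Uq_scale.
Proof. by lift1; crush. Qed.
Lemma Uq_scaleDr : right_distributive Uq_scale +%R.
Proof. by move=> a; do 2 lift1; rewrite /GRing.add /=; crush. Qed.
Lemma Uq_scaleDl u : {morph Uq_scale^~ u : a b / a + b}.
Proof.
move: u; lift1 => a b /=; rewrite /GRing.add /= !Uq_scaleE Uq_addE.
apply: Uq_class_eq; apply: cong_trans (cong_mulDl _ _ _ _).
by apply: cong_mul (cong_refl _ _); apply: cong_scalD.
Qed.

HB.instance Definition _ := GRing.Zmodule_isLmodule.Build K U
  Uq_scaleA Uq_scale1 Uq_scaleDr Uq_scaleDl.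

Lemma Uq_scaleAl (a : K) (u v : U) : a *: (u * v) = (a *: u) * v.
Proof. by move: u v; do 2 lift1; rewrite /GRing.mul /GRing.scale /=; crush. Qed.

HB.instance Definition _ := GRing.Lmodule_isLalgebra.Build K U Uq_scaleAl.

Lemma Uq_scaleAr (a : K) (u v : U) : a *: (u * v) = u * (a *: v).
Proof.
move: u v; do 2 lift1; rewrite /GRing.mul /GRing.scale /=.
rewrite !(Uq_mulE, Uq_scaleE); apply: Uq_class_eq.
apply: cong_trans (cong_mulA _ _ _ _) _; apply: cong_trans.
  by apply: cong_mul (cong_scalC _ _ _) (cong_refl _ _).
exact/cong_sym/cong_mulA.
Qed.

HB.instance Definition _ := GRing.Lalgebra_isAlgebra.Build K U Uq_scaleAr.

Definition Uq_x : U := cl (tGen gen_x).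
Definition Uq_y : U := cl (tGen gen_y).
Definition Uq_yinv : U := cl (tGen gen_yinv).
Definition Uq_z : U := cl (tGen gen_z).

Definition qcomm (u v : U) : U :=
  (q - q^-1)^-1 *: (q *: (u * v) - q^-1 *: (v * u)).

Lemma Uq_class_qcomm t u : cl (tqcomm q t u) = qcomm (cl t) (cl u).
Proof.
rewrite /qcomm /GRing.opp /GRing.add /GRing.mul /GRing.scale /=.
by rewrite !(Uq_mulE, Uq_oppE, Uq_scaleE, Uq_addE).
Qed.

Lemma Uq_yyinv : Uq_y * Uq_yinv = 1.
Proof.
by rewrite /GRing.mul /= Uq_mulE; apply/Uq_class_eq/cong_rel/rel_yyinv.
Qed.
Lemma Uq_yinvy : Uq_yinv * Uq_y = 1.
Proof.
by rewrite /GRing.mul /= Uq_mulE; apply/Uq_class_eq/cong_rel/rel_yinvy.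
Qed.
Lemma Uq_xy : qcomm Uq_x Uq_y = 1.
Proof. by rewrite -Uq_class_qcomm; apply/Uq_class_eq/cong_rel/rel_xy. Qed.
Lemma Uq_yz : qcomm Uq_y Uq_z = 1.
Proof. by rewrite -Uq_class_qcomm; apply/Uq_class_eq/cong_rel/rel_yz. Qed.
Lemma Uq_zx : qcomm Uq_z Uq_x = 1.
Proof. by rewrite -Uq_class_qcomm; apply/Uq_class_eq/cong_rel/rel_zx. Qed.

(* Together with the relations above, these three lemmas are the universal
   property: Uq_lift g is the unique K-algebra morphism sending the class of
   each generator i to g i. *)
Section Lift.
Variables (B : algType K) (g : Uq_gen -> B).
Hypothesis g_rel : forall t u, Uq_rel q t u -> Uq_eval g t = Uq_eval g u.

Definition Uq_lift (u : U) : B := Uq_eval g (Uq_repr u).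

Lemma Uq_liftE t : Uq_lift (cl t) = Uq_eval g t.
Proof. exact: Uq_eval_cong (Uq_repr_cong t). Qed.

Lemma Uq_lift_morph :
  [/\ linear Uq_lift, Uq_lift 1 = 1 & {morph Uq_lift : u v / u * v}].
Proof.
split=> [a||].
- do 2 lift1; rewrite /GRing.scale /= {1}/GRing.add /=.
  by rewrite Uq_scaleE Uq_addE !Uq_liftE /= mulr_algl.
- by rewrite Uq_liftE /= scale1r.
- by do 2 lift1; rewrite {1}/GRing.mul /= Uq_mulE !Uq_liftE.
Qed.

Lemma Uq_lift_unique (f : U -> B) :
    linear f -> f 1 = 1 -> {morph f : u v / u * v} ->
  (forall i, f (cl (tGen i)) = g i) -> f =1 Uq_lift.
Proof.
move=> flin f1 fM fg u; have [t {u}->] := Uq_class_surj u; rewrite Uq_liftE.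
have f0 : f 0 = 0.
  have /= := flin (-1) 0 0.
  by rewrite scaler0 addr0 scaleN1r addNr.
have fZ a v : f (a *: v) = a *: f v by rewrite -[a *: v]addr0 flin f0 addr0.
elim: t => [a|i|t IHt u IHu|t IHt u IHu] //=.
- rewrite -f1 -fZ; congr f; apply: esym.
  by rewrite /GRing.scale /= Uq_scaleE; apply/Uq_class_eq/cong_mul1r.
- rewrite -IHt -IHu -[f _ + f _](_ : f (1 *: cl t + cl u) = _).
    by rewrite scale1r -Uq_addE.
  by rewrite flin scale1r.
- by rewrite -IHt -IHu -fM -Uq_mulE.
Qed.

End Lift.

(* The span of the x^r y^s z^t with r + s + t of parity b. *)
Definition parity_span (b : bool) (u : U) : Prop :=
  exists2 c : seq (K * (nat * nat * nat)),
    all (fun m => let: (_, (r, s, t)) := m in odd (r + s + t) == b) c &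
    u = \sum_(m <- c) let: (a, (r, s, t)) := m in
          a *: (Uq_x ^+ r * Uq_y ^+ s * Uq_z ^+ t).

Definition even_span : {pred U} := fun u => `[< parity_span false u >].

Lemma parity_span0 b : parity_span b 0.
Proof. by exists [::]; rewrite ?big_nil. Qed.

Lemma parity_spanD b u v :
  parity_span b u -> parity_span b v -> parity_span b (u + v).
Proof.
by move=> [c hc ->] [c' hc' ->]; exists (c ++ c'); rewrite ?all_cat ?hc ?big_cat.
Qed.

Lemma parity_spanZ b a u : parity_span b u -> parity_span b (a *: u).
Proof.
move=> [c hc ->]; exists [seq (a * m.1, m.2) | m <- c].
  by rewrite all_map; apply: sub_all hc => -[? [[? ?] ?]].
rewrite scaler_sumr big_map; apply: eq_bigr => -[k [[r s] t]] _ /=.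
by rewrite scalerA.
Qed.

Lemma parity_span_mon b r s t : odd (r + s + t) = b ->
  parity_span b (Uq_x ^+ r * Uq_y ^+ s * Uq_z ^+ t).
Proof.
move=> h; exists [:: (1, (r, s, t))]; first by rewrite /= h eqxx.
by rewrite big_seq1 scale1r.
Qed.

Lemma qcomm_swap u v : qcomm u v = 1 ->
  exists a b : K, v * u = a *: (u * v) + b *: 1.
Proof.
rewrite /qcomm => /(congr1 (fun w => (q * (q - q^-1)) *: w)).
rewrite scalerA mulfK ?subr_inv_neq0 // scalerBr !scalerA mulfV // scale1r.
move=> /eqP; rewrite subr_eq addrC -subr_eq => /eqP <-.
by exists (q * q), (- (q * (q - q^-1))); rewrite scaleNr.
Qed.

Lemma swap_pow (u v : U) a b : v * u = a *: (u * v) + b *: 1 ->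
  forall n, exists a' b', v ^+ n.+1 * u = a' *: (u * v ^+ n.+1) + b' *: v ^+ n.
Proof.
move=> vu; elim=> [|n [a' [b' IH]]]; first by exists a, b; rewrite !expr1.
exists (a' * a), (a' * b + b').
rewrite exprS -mulrA IH mulrDr -!scalerAr (mulrA v u) vu mulrDl scalerDr.
by rewrite -!scalerAl mul1r !scalerA -(mulrA u) -!exprS scalerDl addrA.
Qed.

Lemma parity_span_mulr b g :
    (forall r s t, odd (r + s + t) = b ->
      parity_span (~~ b) (Uq_x ^+ r * Uq_y ^+ s * Uq_z ^+ t * g)) ->
  forall u, parity_span b u -> parity_span (~~ b) (u * g).
Proof.
move=> hg u [c hc ->]; rewrite mulr_suml.
elim: c hc => [|[a [[r s] t]] c IH] /=; rewrite ?big_nil ?big_cons.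
  by move=> _; apply: parity_span0.
case/andP=> /eqP hb /IH; apply: parity_spanD.
by rewrite -scalerAl; apply/parity_spanZ/hg.
Qed.

Lemma parity_span_mulz b u : parity_span b u -> parity_span (~~ b) (u * Uq_z).
Proof.
move: u; apply: parity_span_mulr => r s t h.
by rewrite -mulrA -exprSr; apply: parity_span_mon; rewrite addnS /= h.
Qed.

Lemma parity_span_muly b u : parity_span b u -> parity_span (~~ b) (u * Uq_y).
Proof.
move: u; apply: parity_span_mulr => r s [|t] h.
  rewrite mulr1 -mulrA -exprSr -[_ * _]mulr1.
  by apply: (@parity_span_mon _ r s.+1 0); rewrite -h !addn0 addnS.
have [a [e zy]] := qcomm_swap Uq_yz; have [a' [e' zty]] := swap_pow zy t.
rewrite -mulrA zty mulrDr -!scalerAr; apply: parity_spanD; apply: parity_spanZ.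
  rewrite mulrA -[X in X * _]mulrA -exprSr.
  by apply: parity_span_mon; rewrite -h !addnS addSn.
by apply: parity_span_mon; rewrite -h addnS /= negbK.
Qed.

Lemma parity_span_mulx b u : parity_span b u -> parity_span (~~ b) (u * Uq_x).
Proof.
move: u; apply: parity_span_mulr => r s t h.
have [a [e yx]] := qcomm_swap Uq_xy.
have base : parity_span (~~ b) (Uq_x ^+ r * (Uq_y ^+ s * Uq_x) * Uq_z ^+ t).
  case: s h => [|s] h.
    rewrite mul1r -exprSr -[X in X * _]mulr1.
    by apply: (@parity_span_mon _ r.+1 0 t); rewrite -h !addn0 addSn.
  have [a' [e' ysx]] := swap_pow yx s.
  rewrite ysx mulrDr mulrDl -!scalerAr -!scalerAl.
  apply: parity_spanD; apply: parity_spanZ.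
    by rewrite mulrA -exprSr; apply: parity_span_mon; rewrite -h !addSn.
  by apply: parity_span_mon; rewrite -h addnS addSn /= negbK.
case: t h base => [|t] h base; first by move: base; rewrite !mulr1 mulrA.
have qcxz : Uq_z * Uq_x = (q^-1 * q^-1) *: (Uq_x * Uq_z) +
    (q^-1 * (q - q^-1)) *: 1.
  have := Uq_zx; rewrite /qcomm => /(congr1 (fun w => (q - q^-1) *: w)).
  rewrite scalerA mulfV ?subr_inv_neq0 // scale1r => /eqP.
  rewrite subr_eq => /eqP /(congr1 (fun w => q^-1 *: w)).
  by rewrite scalerDr !scalerA mulVf // scale1r addrC.
have [a' [e' ztx]] := swap_pow qcxz t.
rewrite -mulrA ztx mulrDr -!scalerAr; apply: parity_spanD; apply: parity_spanZ.
  by rewrite mulrA -[X in X * _]mulrA.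
by apply: parity_span_mon; rewrite -h addnS /= negbK.
Qed.

Lemma parity_spanM b b' u v :
  parity_span b u -> parity_span b' v -> parity_span (b (+) b') (u * v).
Proof.
have pow g : (forall b u, parity_span b u -> parity_span (~~ b) (u * g)) ->
    forall n b u, parity_span b u -> parity_span (b (+) odd n) (u * g ^+ n).
  move=> hg; elim=> [|n IH] c w hw; first by rewrite addbF mulr1.
  by rewrite exprS mulrA /= addbN -addNb; apply/IH/hg.
move=> hu [c hc ->]; rewrite mulr_sumr.
elim: c hc => [|[a [[r s] t]] c IH] /=; rewrite ?big_nil ?big_cons.
  by move=> _; apply: parity_span0.
case/andP=> /eqP hb /IH; apply: parity_spanD.
rewrite -hb -scalerAr; apply: parity_spanZ; rewrite !oddD !addbA !mulrA.
apply: (pow _ parity_span_mulz); apply: (pow _ parity_span_muly).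
exact: (pow _ parity_span_mulx).
Qed.

Lemma even_span_subalg_closed : GRing.subalg_closed even_span.
Proof.
split.
- apply/asboolP.
  by have /= := @parity_span_mon false 0 0 0 erefl; rewrite !expr0 !mulr1.
- move=> a u v /asboolP hu /asboolP hv.
  exact/asboolP/parity_spanD/hv/parity_spanZ.
- by move=> u v /asboolP hu /asboolP hv; apply/asboolP/(parity_spanM hu hv).
Qed.

HB.instance Definition _ := GRing.isSubalgClosed.Build K U even_span
  even_span_subalg_closed.

(* The algebra denoted by a calligraphic A; it inherits its algebra structure
   from U_q(sl_2). *)
Record even_subalg := EvenSubalg { even_val : U; _ : even_val \in even_span }.

HB.instance Definition _ := [isSub for even_val].
HB.instance Definition _ := [Choice of even_subalg by <:].
HB.instance Definition _ := [SubChoice_isSubAlgebra of even_subalg by <:].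

End UqAlgebra.

(* Left modules: a vectType is finite-dimensional, and the action is a
   K-algebra morphism to the endomorphisms under composition. *)
Record fdmodule (K : fieldType) (A : algType K) := FDModule {
  fdm_space :> vectType K;
  fdm_act : {linear A -> 'End(fdm_space)};
  fdm_act1 : fdm_act 1 = \1%VF;
  fdm_actM : forall a b, fdm_act (a * b) = (fdm_act a \o fdm_act b)%VF
}.

Section Modules.
Variables (K : fieldType) (A : algType K).

Definition submodule (M : fdmodule A) (W : {vspace M}) : Prop :=
  forall a : A, (fdm_act M a @: W <= W)%VS.

Definition irreducible (M : fdmodule A) : Prop :=
  (fullv : {vspace M}) <> 0%VS /\
  forall W : {vspace M}, submodule W -> W = 0%VS \/ W = fullv.

Definition fdm_iso (M N : fdmodule A) : Prop :=
  exists2 f : 'Hom(M, N), bijective f &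
    forall (a : A) (v : M), f (fdm_act M a v) = fdm_act N a (f v).

End Modules.

(* Main.v *)
From HB Require Import structures.
Require Import Defs.
From mathcomp Require Import all_boot all_order all_algebra.
From mathcomp Require Import boolp ring zify.
Import GRing.Theory passmx.
Local Open Scope ring_scope.

Set Implicit Arguments.
Unset Strict Implicit.
Unset Printing Implicit Defensive.

(** Write Q for q^2 and put E = 1 - yz, F = 1 - xy and k = y^2, all of them even.
    They satisfy relations of Chevalley type,
    E k = Q^2 k E,  k F = Q^2 F k,  E F = Q F E + (Q^-1 - 1)(1 - k),
    so E and F multiply k-weights by Q^-2 and Q^2.  The even subalgebra is generated by
    x^2, xy, xz, y^2, yz and z^2 ([even_subalg_ind]); of these, xy, yz and y^2
    are 1 - F, 1 - E and k, while x^2, xz and z^2 become polynomials in E and F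
    once multiplied by k.  Hence, where k acts injectively, the action of the
    whole algebra is determined by E, F and k ([even_intertwiner]), and the
    classification is the one by highest weights.

    Since y is invertible only in the larger algebra, injectivity of k has to
    be proved ([k_act_inj]).  The product z^2 y^2 is a polynomial in E, so E has
    an eigenvector in a nonzero kernel of k; repeated application of z^2 then
    yields eigenvectors of E for infinitely many eigenvalues, which is
    impossible in finite dimension ([eigenvectors_vanish]).  The same
    impossibility, applied to conjugation by k on the endomorphism ring, makes E
    and F nilpotent ([qcommute_nilpotent]).

    The field need not be algebraically closed, so an eigenvector of k in the
    kernel of E has to be produced by hand.  For v in that kernel, E F^(n+1) v
    is a nonzero multiple of F^n (v - Q^n k v); if F^(n+1) v = 0, either v has
    k-weight Q^-n or v - Q^n k v is a nonzero vector of the kernel already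
    killed by F^n.  Induction ends at a vector w of k-weight Q^-m with
    F^(m+1) w = 0 ([highest_weight_from]).

    Such a w is exactly what is needed to map the explicit module of dimension
    m + 1 to the given one ([model_from_highest_weight]).  The explicit module
    is irreducible ([model_irreducible]), so by Schur's lemma the map is an
    isomorphism, and comparing dimensions gives m = d. *)

(** * Powers of a scalar and eigenvectors *)

Lemma nru_expr_inj (K : fieldType) (q : K) : q != 0 -> not_root_of_unity q ->
  injective (fun n => q ^+ n).
Proof.
move=> q0 qn; suff le m n : (m <= n)%N -> q ^+ m = q ^+ n -> m = n.
  by move=> m n /= e; case: (leqP m n) => [|/ltnW] h; [|symmetry]; exact: le.
move=> h e; apply/eqP; rewrite eqn_leq h /= leqNgt; apply/negP => lt.
have /(_ _)/negP : (0 < n - m)%N -> q ^+ (n - m) != 1 by exact: qn.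
by rewrite subn_gt0 => /(_ lt); apply; rewrite expfB // e mulfV // expf_neq0.
Qed.

Lemma nru_pow (K : fieldType) (q : K) k : (0 < k)%N ->
  not_root_of_unity q -> not_root_of_unity (q ^+ k).
Proof. by move=> k0 qn n n0; rewrite -exprM qn // muln_gt0 k0. Qed.

Lemma nru_inv (K : fieldType) (q : K) :
  not_root_of_unity q -> not_root_of_unity q^-1.
Proof. by move=> qn n n0; rewrite exprVn invr_eq1 qn. Qed.

(** Infinitely many distinct eigenvalues would be infinitely many roots of the
    characteristic polynomial. *)
Lemma eigenvectors_vanish (K : fieldType) (V : vectType K) (T : 'End(V))
    (c : nat -> K) (w : nat -> V) : injective c ->
  (forall j, T (w j) = c j *: w j) -> exists j, w j = 0.
Proof.
move=> cI Tw; set n := \dim {:V}.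
have [/existsP [j /eqP wj]|] := boolP [exists j : 'I_n.+1, w j == 0].
  by exists j.
rewrite negb_exists => /forallP wN0; exfalso.
pose e := vbasis {:V}; have eP : basis_of {:V} e := vbasisP _.
pose g := mxof e e T; pose rs := [seq c i | i <- iota 0 n.+1].
have rsP : all (root (char_poly g)) rs.
  apply/allP => _ /mapP [j + ->]; rewrite mem_iota add0n => /= ltj.
  rewrite -eigenvalue_root_char; apply/eigenvalueP.
  exists (rVof e (w j)).
    by rewrite -rVof_app // Tw linearZ.
  by rewrite rVof_eq0 //; exact: (wN0 (Ordinal ltj)).
have := max_poly_roots (monic_neq0 (char_poly_monic g)) rsP.
rewrite map_inj_uniq ?iota_uniq // => /(_ isT).
by rewrite size_map size_iota size_char_poly ltnn.
Qed.

Lemma qcommute_exprr (K : fieldType) (B : algType K) (c : K) (a b : B) n :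
  a * b = c *: (b * a) -> a * b ^+ n = c ^+ n *: (b ^+ n * a).
Proof.
move=> ab; elim: n => [|n IH]; first by rewrite !expr0 scale1r mulr1 mul1r.
by rewrite [in LHS]exprS mulrA ab -scalerAl -(mulrA b a) IH
  -scalerAr scalerA mulrA -!exprS.
Qed.

Lemma qcommute_exprl (K : fieldType) (B : algType K) (c : K) (a b : B) n :
  a * b = c *: (b * a) -> a ^+ n * b = c ^+ n *: (b * a ^+ n).
Proof.
move=> ab; elim: n => [|n IH]; first by rewrite !expr0 scale1r mulr1 mul1r.
by rewrite [in LHS]exprSr -mulrA ab -scalerAr mulrA IH
  -scalerAl scalerA -mulrA -exprS -exprSr.
Qed.

(** * Identities in the equitable presentation *)

Section EquitableRelations.
Variables (K : fieldType) (Q : K) (B : algType K) (x y z : B).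
Hypothesis Q_neq0 : Q != 0.
Hypothesis yxE : y * x = Q *: (x * y) + (1 - Q) *: 1.
Hypothesis zyE : z * y = Q *: (y * z) + (1 - Q) *: 1.
Hypothesis xzE : x * z = Q *: (z * x) + (1 - Q) *: 1.
Local Notation E := (1 - y * z).
Local Notation F := (1 - x * y).

Lemma eq_zy : z * y = 1 - Q *: E.
Proof. by rewrite zyE scalerBr scalerBl scale1r opprB addrCA. Qed.

Lemma eq_yx : y * x = 1 - Q *: F.
Proof. by rewrite yxE scalerBr scalerBl scale1r opprB addrCA. Qed.

Lemma eq_Ey : E * y = Q *: (y * E).
Proof. by rewrite mulrBl mul1r -mulrA eq_zy mulrBr mulr1 -scalerAr subKr. Qed.

Lemma eq_zE : z * E = Q *: (E * z).
Proof. by rewrite mulrBr mulr1 mulrA eq_zy mulrBl mul1r -scalerAl subKr. Qed.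

Lemma eq_yF : y * F = Q *: (F * y).
Proof. by rewrite mulrBr mulr1 mulrA eq_yx mulrBl mul1r -scalerAl subKr. Qed.

Lemma eq_EK : E * y ^+ 2 = Q ^+ 2 *: (y ^+ 2 * E).
Proof. exact: qcommute_exprr eq_Ey. Qed.

Lemma eq_KF : y ^+ 2 * F = Q ^+ 2 *: (F * y ^+ 2).
Proof. exact: qcommute_exprl eq_yF. Qed.

Lemma eq_z2E : z ^+ 2 * E = Q ^+ 2 *: (E * z ^+ 2).
Proof. exact: qcommute_exprl eq_zE. Qed.

(** The left factor z y is 1 - Q E; moving 1 - Q E past y multiplies E by Q. *)
Lemma eq_z2K : z ^+ 2 * y ^+ 2 = (1 - Q *: E) * (1 - Q ^+ 2 *: E).
Proof.
have past_y : (1 - Q *: E) * y = y * (1 - Q ^+ 2 *: E).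
  by rewrite [RHS]mulrBr -scalerAr [LHS]mulrBl -scalerAl eq_Ey scalerA mulr1 mul1r.
by rewrite -eq_zy -(mulrA z y) -past_y -eq_zy !expr2 !mulrA.
Qed.

Lemma eq_Kz2 : y ^+ 2 * z ^+ 2 = (1 - E) * (1 - Q^-1 *: E).
Proof.
have past_z : (1 - E) * z = z * (1 - Q^-1 *: E).
  rewrite [RHS]mulrBr -scalerAr eq_zE scalerA mulVf // scale1r mulr1.
  by rewrite [LHS]mulrBl mul1r.
by rewrite {1}subKr -(mulrA y z) -past_z subKr !expr2 !mulrA.
Qed.

Lemma eq_y_past : y * (1 - Q *: F) = (1 - Q ^+ 2 *: F) * y.
Proof.
by rewrite [LHS]mulrBr -scalerAr eq_yF scalerA [RHS]mulrBl -scalerAl mulr1 mul1r.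
Qed.

Lemma eq_Kx2 : y ^+ 2 * x ^+ 2 = (1 - Q ^+ 2 *: F) * (1 - Q *: F).
Proof. by rewrite -eq_yx [RHS]mulrA -eq_y_past -eq_yx !expr2 !mulrA. Qed.

Lemma eq_Kxz : y ^+ 2 * (x * z) = (1 - Q ^+ 2 *: F) * (1 - E).
Proof. by rewrite subKr [RHS]mulrA -eq_y_past -eq_yx !expr2 !mulrA. Qed.

(** Expanding E F leaves the quartic term y z x y.  Trading z x for
    x z turns it into (y x)(z y), a product of polynomials in F and E, up to a
    multiple of y^2. *)
Lemma eq_EF :
  E * F = Q *: (F * E) + (Q^-1 - 1) *: (1 - y ^+ 2).
Proof.
have EFe : E * F = E + F - 1 + y * (z * x) * y.
  have -> : E + F - 1 = F - y * z by rewrite addrC -addrA addKr addrC.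
  by rewrite [LHS]mulrBl mul1r [y * z * F]mulrBr mulr1 !mulrA opprB addrA
    addrAC.
have yzxy : Q *: (y * (z * x) * y) =
    (1 - Q *: F) * (1 - Q *: E) - (1 - Q) *: y ^+ 2.
  rewrite scalerAl scalerAr.
  have -> : Q *: (z * x) = x * z - (1 - Q) *: 1 by rewrite xzE addrK.
  by rewrite mulrBr mulrBl -eq_yx -eq_zy !mulrA -scalerAr mulr1 -scalerAl expr2.
apply: (scalerI Q_neq0); rewrite EFe scalerDr yzxy.
have -> : (1 - Q *: F) * (1 - Q *: E) = 1 - Q *: F - Q *: E + Q *: (Q *: (F * E)).
  rewrite [LHS]mulrBl mul1r [Q *: F * _]mulrBr mulr1 -scalerAr -scalerAl.
  by rewrite opprB addrA addrAC (addrAC 1).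
set g := F * E; set e := E; set f := F; clearbody g e f.
rewrite [RHS]scalerDr (scalerA Q (Q^-1 - 1)) mulrBr mulfV // mulr1.
rewrite (scalerBr (1 - Q)) !addrA.
congr (_ - _); rewrite [RHS]addrC; congr (_ + _).
rewrite scalerBr scalerDr scalerBl scale1r -(addrA _ (- (Q *: f))) -opprD.
rewrite (addrC (Q *: f)) -(addrA (Q *: e + Q *: f)) addrAC subrr add0r.
exact: addrC.
Qed.

End EquitableRelations.

(** The coefficient Q^-1 - Q^n is (Q^-1 - 1)(1 + Q + ... + Q^n); it vanishes only
    when Q^(n+1) = 1. *)
Lemma E_past_Fn (K : fieldType) (Q : K) (B : algType K) (E F k : B) n :
  Q != 0 -> k * F = Q ^+ 2 *: (F * k) ->
  E * F = Q *: (F * E) + (Q^-1 - 1) *: (1 - k) ->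
  E * F ^+ n.+1 = Q ^+ n.+1 *: (F ^+ n.+1 * E)
    + (Q^-1 - Q ^+ n) *: (F ^+ n * (1 - Q ^+ n *: k)).
Proof.
move=> Q0 kF EF; elim: n => [|n IH].
  by rewrite !expr1 !expr0 scale1r mul1r.
rewrite [in LHS]exprS mulrA EF mulrDl -!scalerAl -mulrA IH.
rewrite [(1 - k) * _]mulrBl mul1r (qcommute_exprr n.+1 kF).
rewrite (mulrDr F) -!scalerAr !mulrA -!exprS scalerDr scalerA -exprS -addrA.
congr (_ + _); rewrite !mulrBr !mulr1 -!scalerAr !scalerBr !scalerA addrACA.
rewrite -opprD -!scalerDl -(exprM Q) mulnC exprM !(exprS Q n).
congr (_ *: _ - _ *: _); move: (Q ^+ n) => s; by field.
Qed.

(** * The even subalgebra and its generators *)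

Section EvenSubalgebra.
Variables (K : fieldType) (q : K) (q_neq0 : q != 0) (q_nru : not_root_of_unity q).
Local Notation U := (Uq q_neq0 q_nru).
Local Notation A := (even_subalg q_neq0 q_nru).
Local Notation x := (Uq_x q_neq0 q_nru).
Local Notation y := (Uq_y q_neq0 q_nru).
Local Notation z := (Uq_z q_neq0 q_nru).
Local Notation Q := (q ^+ 2).

(** The three defining relations in the rewriting form used above, cleared of the
    denominator q - q^-1. *)
Lemma qcomm1_swap (u v : U) :
  qcomm u v = 1 -> v * u = Q *: (u * v) + (1 - Q) *: 1.
Proof.
move=> /(congr1 (fun w => (q * (q - q^-1)) *: w)).
rewrite /qcomm scalerA mulfK ?subr_inv_neq0 // scalerBr !scalerA mulfV // scale1r.
move=> /eqP; rewrite subr_eq addrC -subr_eq => /eqP <-.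
by rewrite mulrBr mulfV // -[in LHS]expr2 -scaleNr opprB.
Qed.

Lemma parity_x : parity_span true x.
Proof.
by have := @parity_span_mon K q q_neq0 q_nru true 1 0 0 erefl; rewrite !mulr1.
Qed.
Lemma parity_y : parity_span true y.
Proof.
by have := @parity_span_mon K q q_neq0 q_nru true 0 1 0 erefl; rewrite mulr1 mul1r.
Qed.
Lemma parity_z : parity_span true z.
Proof.
by have := @parity_span_mon K q q_neq0 q_nru true 0 0 1 erefl; rewrite !mul1r.
Qed.

Definition odd_mul (u v : U) (hu : parity_span true u) (hv : parity_span true v)
  : A := EvenSubalg (introT (asboolP _) (parity_spanM hu hv)).

Definition evX2 : A := odd_mul parity_x parity_x.
Definition evXY : A := odd_mul parity_x parity_y.
Definition evXZ : A := odd_mul parity_x parity_z.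
Definition evK : A := odd_mul parity_y parity_y.
Definition evYZ : A := odd_mul parity_y parity_z.
Definition evZ2 : A := odd_mul parity_z parity_z.
Definition evE : A := 1 - evYZ.
Definition evF : A := 1 - evXY.

Let Q_neq0 : Q != 0. Proof. exact: expf_neq0. Qed.
Let yx := qcomm1_swap (Uq_xy q_neq0 q_nru).
Let zy := qcomm1_swap (Uq_yz q_neq0 q_nru).
Let xz := qcomm1_swap (Uq_zx q_neq0 q_nru).

Lemma ev_EK : evE * evK = Q ^+ 2 *: (evK * evE).
Proof. apply: val_inj. exact: (eq_EK zy). Qed.
Lemma ev_KF : evK * evF = Q ^+ 2 *: (evF * evK).
Proof. apply: val_inj. exact: (eq_KF yx). Qed.
Lemma ev_EF : evE * evF = Q *: (evF * evE) + (Q^-1 - 1) *: (1 - evK).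
Proof. apply: val_inj. exact: (eq_EF Q_neq0 yx zy xz). Qed.
Lemma ev_Z2E : evZ2 * evE = Q ^+ 2 *: (evE * evZ2).
Proof. apply: val_inj. exact: (eq_z2E zy). Qed.
Lemma ev_Z2K : evZ2 * evK = (1 - Q *: evE) * (1 - Q ^+ 2 *: evE).
Proof. apply: val_inj. exact: (eq_z2K zy). Qed.
Lemma ev_KZ2 : evK * evZ2 = (1 - evE) * (1 - Q^-1 *: evE).
Proof. apply: val_inj. exact: (eq_Kz2 Q_neq0 zy). Qed.
Lemma ev_KX2 : evK * evX2 = (1 - Q ^+ 2 *: evF) * (1 - Q *: evF).
Proof. apply: val_inj. exact: (eq_Kx2 yx). Qed.
Lemma ev_KXZ : evK * evXZ = (1 - Q ^+ 2 *: evF) * (1 - evE).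
Proof. apply: val_inj. exact: (eq_Kxz z yx). Qed.

(** A word of even length in x, y, z is a product of pairs of letters; the order
    of the letters in x^r y^s z^t allows only the six pairs listed here. *)
Lemma even_subalg_ind (P : A -> Prop) :
    P 1 -> (forall a b, P a -> P b -> P (a * b)) ->
    (forall k a b, P a -> P b -> P (k *: a + b)) ->
    P evX2 -> P evXY -> P evXZ -> P evK -> P evYZ -> P evZ2 ->
  forall a, P a.
Proof.
move=> P1 PM PL Pxx Pxy Pxz Pyy Pyz Pzz a.
pose R (u : U) := exists2 b : A, even_val b = u & P b.
have RM u v : R u -> R v -> R (u * v).
  by move=> [b <- Pb] [b' <- Pb']; exists (b * b'); last exact: PM.
have R1 : R 1 by exists 1.
have RX u n : R (u * u) -> R (u ^+ n.*2).
  move=> Ru; rewrite -mul2n exprM; elim: n => [|n IH] //.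
  by rewrite exprS; apply: (RM).
have Rxx : R (x * x) by exists evX2.
have Rxy : R (x * y) by exists evXY.
have Rxz : R (x * z) by exists evXZ.
have Ryy : R (y * y) by exists evK.
have Ryz : R (y * z) by exists evYZ.
have Rzz : R (z * z) by exists evZ2.
(* Squares of x on the left and of z on the right split off, which leaves
   exponents 0 or 1 at both ends. *)
have Rmid r s t : ~~ odd (r + s + t) -> (r < 2)%N -> (t < 2)%N ->
    R (x ^+ r * y ^+ s * z ^+ t).
  case: r => [|[]] //; case: t => [|[]] //; rewrite ?addn0 ?addn1 ?add0n ?add1n /=
    ?expr1 ?expr0 ?mul1r ?mulr1 ?negbK => h _ _.
  - by rewrite -(odd_double_half s) (negbTE h); apply: (RX).
  - by rewrite -(odd_double_half s) h addnC exprD -mulrA; apply: (RM); [apply: (RX)|].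
  - by rewrite -(odd_double_half s) h exprD mulrA; apply: (RM); [|apply: (RX)].
  - rewrite -(odd_double_half s) (negbTE h) add0n.
    case: (s./2) => [|n]; first by rewrite mulr1.
    rewrite doubleS exprS exprSr !mulrA -(mulrA _ y z) -(mulrA (x * y)).
    by apply: (RM) => //; apply: (RM) => //; apply: (RX).
have Rmon r s t : ~~ odd (r + s + t) -> R (x ^+ r * y ^+ s * z ^+ t).
  move=> h; rewrite -(odd_double_half r) -(odd_double_half t) addnC.
  rewrite (exprD x) (exprD z) !mulrA.
  apply: (RM); last by apply: (RX).
  rewrite -!mulrA; apply: (RM); first by apply: (RX).
  rewrite mulrA; apply: Rmid; rewrite ?ltnS ?leq_b1 //.
  by move: h; rewrite !oddD !oddb.
have Reven u : parity_span false u -> R u.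
  move=> [c hc ->]; elim: c hc => [_|[k [[r s] t]] c IH].
    rewrite big_nil; exists 0 => //.
    by rewrite -(subrr 1) addrC -scaleN1r; apply: PL.
  move=> /= /andP [/eqP h /IH [b bE Pb]]; rewrite big_cons -bE.
  have [|b' <- Pb'] := Rmon r s t; first by rewrite h.
  by exists (k *: b' + b); last exact: PL.
have [|b /val_inj <- //] := Reven (even_val a).
exact/asboolP/(valP a).
Qed.

End EvenSubalgebra.

(** * Modules over an arbitrary algebra *)

Section ModuleTheory.
Variables (K : fieldType) (A : algType K).
Implicit Types (M N : fdmodule A) (a b : A).

(** Naming this application gives it a type that mentions only the algebra and the
    module, so that rewriting does not depend on the structures carried by the space
    of endomorphisms. *)
Definition act N a (v : N) : N := fdm_act N a v.

Lemma act_linear N a : linear (act (N := N) a).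
Proof. by move=> c u v; rewrite /act linearP. Qed.

HB.instance Definition _ N a := GRing.isLinear.Build K N N _ (act (N := N) a)
  (act_linear a).

Lemma act1 N (v : N) : act 1 v = v.
Proof. by rewrite /act fdm_act1 id_lfunE. Qed.

Lemma actM N a b (v : N) : act (a * b) v = act a (act b v).
Proof. by rewrite /act fdm_actM comp_lfunE. Qed.

Lemma actD N a b (v : N) : act (a + b) v = act a v + act b v.
Proof. by rewrite /act linearD add_lfunE. Qed.

Lemma actN N a (v : N) : act (- a) v = - act a v.
Proof. by rewrite /act linearN opp_lfunE. Qed.

Lemma actZ N k a (v : N) : act (k *: a) v = k *: act a v.
Proof. by rewrite /act linearZ scale_lfunE. Qed.

Definition actE := (actD, actN, actZ, actM, act1).

Lemma act_exprS N a n (v : N) :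
  act (a ^+ n.+1) v = act a (act (a ^+ n) v).
Proof. by rewrite exprS actM. Qed.

(** Conjugation by a multiplies b^n by c^n, so the powers of b are eigenvectors of
    one linear map on the endomorphism space, for distinct eigenvalues; some power
    must act as zero. *)
Lemma qcommute_nilpotent N a b (c : K) :
  c != 0 -> not_root_of_unity c -> injective (act (N := N) a) ->
  a * b = c *: (b * a) -> exists n, forall v : N, act (b ^+ n) v = 0.
Proof.
move=> c0 cn /lker0P a0 ab; set f := fdm_act N a in a0.
have T_lin : linear (fun X : 'End(N) => (f \o X \o f^-1)%VF).
  by move=> k X Y; rewrite comp_lfunDr comp_lfunDl -comp_lfunZr -comp_lfunZl.
pose T : {linear 'End(N) -> 'End(N)} := HB.pack
  (fun X : 'End(N) => (f \o X \o f^-1)%VF)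
  (GRing.isLinear.Build K 'End(N) 'End(N) _ _ T_lin).
have [n|n bn0] := @eigenvectors_vanish _ _ (linfun T) _
  (fun n => fdm_act N (b ^+ n)) (nru_expr_inj c0 cn); last first.
  by exists n => v; rewrite /act bn0 zero_lfunE.
rewrite lfunE /= /f -fdm_actM (qcommute_exprr n ab) linearZ fdm_actM -comp_lfunZl.
by rewrite lker0_compfK.
Qed.

Lemma nilpotent_kernel N a n (v : N) : v != 0 -> act (a ^+ n) v = 0 ->
  exists2 w : N, w != 0 & act a w = 0.
Proof.
move=> v0; elim: n => [|n IH]; first by rewrite act1 => vE; rewrite vE eqxx in v0.
rewrite act_exprS => avn.
by have [/IH|] := eqVneq (act (a ^+ n) v) 0; last by exists (act (a ^+ n) v).
Qed.

Lemma schur M N (f : 'Hom(M, N)) : irreducible M -> irreducible N ->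
    f != 0 -> (forall a v, f (act a v) = act a (f v)) ->
  fdm_iso N M /\ \dim {:M} = \dim {:N}.
Proof.
move=> [_ irrM] [_ irrN] f0 fA.
have ker0 : lker f == 0%VS.
  have [|-> //|kerT] := irrM (lker f).
    move=> a; apply/subvP => _ /memv_imgP [v vk ->].
    by move: vk; rewrite !memv_ker (fA a) => /eqP ->; rewrite linear0.
  case/eqP: f0; apply/lfunP => v; rewrite zero_lfunE; apply/eqP.
  by rewrite -memv_ker kerT memvf.
have imgT : limg f = fullv.
  have [|img0|//] := irrN (limg f).
    move=> a; apply/subvP => _ /memv_imgP [_ /memv_imgP [v _ ->] ->].
    by rewrite -[fdm_act N a _]fA memv_img ?memvf.
  case/eqP: f0; apply/lfunP => v; rewrite zero_lfunE; apply/eqP.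
  by rewrite -memv0 -img0 memv_img ?memvf.
have fK : cancel f f^-1%VF by exact: lker0_lfunK.
have fVK : cancel f^-1%VF f by move=> v; rewrite limg_lfunVK ?imgT ?memvf.
split; last by rewrite -imgT limg_dim_eq // (eqP ker0) capv0.
exists f^-1%VF; first by exists f.
by move=> a v; rewrite -{1}(fVK v) -[fdm_act N a _]fA fK.
Qed.

End ModuleTheory.

(** * Existence of highest weight vectors *)

Section WeightTheory.
Variables (K : fieldType) (Q : K) (A : algType K) (E F k Z2 : A) (N : fdmodule A).
Hypotheses (Q_neq0 : Q != 0) (Q_nru : not_root_of_unity Q).
Hypothesis EK : E * k = Q ^+ 2 *: (k * E).
Hypothesis KF : k * F = Q ^+ 2 *: (F * k).
Hypothesis EF : E * F = Q *: (F * E) + (Q^-1 - 1) *: (1 - k).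
Hypothesis Z2E : Z2 * E = Q ^+ 2 *: (E * Z2).
Hypothesis Z2K : Z2 * k = (1 - Q *: E) * (1 - Q ^+ 2 *: E).
Hypothesis KZ2 : k * Z2 = (1 - E) * (1 - Q^-1 *: E).

(** On the kernel of k the identity Z2 k = (1 - Q E)(1 - Q^2 E) forces an
    eigenvector w of E with eigenvalue Q^-m, where m is 1 or 2.  The vectors Z2^j w
    have eigenvalues Q^-(m + 2j), and none of them is zero: by the formula for k Z2,
    the vector k Z2 (Z2^j w) is a multiple of Z2^j w whose coefficient would vanish
    only for the eigenvalues 1 and Q.  So E would have infinitely many. *)
Lemma k_act_eq0 (v : N) : act k v = 0 -> v = 0.
Proof.
move=> kv; apply/eqP/negPn/negP => v0.
have [m m0 [w w0 [kw Ew]]] : exists2 m, (0 < m)%N & exists2 w : N, w != 0 &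
    act k w = 0 /\ act E w = Q ^- m *: w.
  have := congr1 (fun a => act a v) Z2K.
  rewrite /= actM kv linear0 actM; set u := act (1 - _ *: _) v => uE.
  have [u0|u_neq0] := eqVneq u 0.
    exists 2 => //; exists v => //; split=> //; apply: (scalerI (expf_neq0 2 Q_neq0)).
    rewrite scalerA mulfV ?expf_neq0 // scale1r; apply/eqP.
    by rewrite eq_sym -subr_eq0 -u0 /u !actE.
  exists 1%N => //; exists u => //; split.
    rewrite /u !actE linearB linearZ /= kv sub0r.
    have := congr1 (fun a => act a v) EK.
    rewrite /= !actE kv linear0 => /esym/eqP.
    rewrite scaler_eq0 expf_eq0 (negbTE Q_neq0) /= => /eqP ->.
    by rewrite scaler0 oppr0.
  apply: (scalerI Q_neq0); rewrite scalerA mulfV // scale1r; apply/eqP.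
  by move/esym/eqP: uE; rewrite !actE subr_eq0 eq_sym.
pose ws j := act (Z2 ^+ j) w.
have Ews j : act E (ws j) = Q ^- (m + j.*2) *: ws j.
  have := congr1 (fun a => act a w) (qcommute_exprl j Z2E).
  rewrite /= !actE Ew linearZ /= -/(ws j) => /(congr1 (fun u => Q ^- j.*2 *: u)).
  rewrite !scalerA -exprM mul2n mulVf ?expf_neq0 // scale1r => <-.
  by rewrite -invfM -exprD addnC.
have ws0 j : ws j != 0.
  elim: j => [|j IH]; first by rewrite /ws act1.
  apply/eqP => wsS; have := congr1 (fun a => act a (ws j)) KZ2.
  have inner : act (1 - Q^-1 *: E) (ws j) = (1 - Q ^- (m + j.*2).+1) *: ws j.
    by rewrite !actE Ews scalerA -invfM -exprS scalerBl scale1r.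
  have outer : act (1 - E) (ws j) = (1 - Q ^- (m + j.*2)) *: ws j.
    by rewrite !actE Ews scalerBl scale1r.
  rewrite /= actM -act_exprS -/(ws _) wsS linear0 actM inner linearZ /= outer scalerA.
  move=> /esym/eqP; rewrite scaler_eq0 (negbTE IH) orbF mulf_eq0 !subr_eq0.
  by rewrite !(eq_sym 1) !invr_eq1 !(negbTE (Q_nru _)) // addn_gt0 m0.
have [j wj0] : exists j, ws j = 0.
  apply: (@eigenvectors_vanish _ _ (fdm_act N E) _ _ _ Ews) => i j /=.
  rewrite -!exprVn => /nru_expr_inj; rewrite invr_neq0 // => /(_ isT (nru_inv Q_nru)).
  by move/addnI/double_inj.
by have := ws0 j; rewrite wj0 eqxx.
Qed.

Lemma k_act_inj : injective (act (N := N) k).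
Proof.
move=> u v /eqP; rewrite -subr_eq0 -linearB => /eqP /k_act_eq0 /eqP.
by rewrite subr_eq0 => /eqP.
Qed.

Lemma F_act_nilpotent : exists n, forall v : N, act (F ^+ n) v = 0.
Proof.
exact: qcommute_nilpotent (expf_neq0 2 Q_neq0) (nru_pow _ Q_nru) k_act_inj KF.
Qed.

Lemma E_act_nilpotent : exists n, forall v : N, act (E ^+ n) v = 0.
Proof.
apply: (@qcommute_nilpotent _ _ N k E (Q ^+ 2)^-1 _ _ k_act_inj).
- by rewrite invr_neq0 // expf_neq0.
- exact/nru_inv/nru_pow.
- by rewrite EK scalerA mulVf ?expf_neq0 // scale1r.
Qed.

Lemma E_act_Fn n (v : N) : act E v = 0 ->
  act E (act (F ^+ n.+1) v) =
    (Q^-1 - Q ^+ n) *: act (F ^+ n) (v - Q ^+ n *: act k v).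
Proof.
move=> Ev; rewrite -actM (E_past_Fn n Q_neq0 KF EF) actD !actZ !actM Ev linear0.
by rewrite scaler0 add0r !actE.
Qed.

(** When v is not yet an eigenvector of k, v - Q^n k v is again in the kernel of E
    and F^n already kills it. *)
Lemma highest_weight_from (n : nat) (v : N) :
    v != 0 -> act E v = 0 -> act (F ^+ n) v = 0 ->
  exists m (w : N), [/\ w != 0, act E w = 0, act k w = Q ^- m *: w &
    act (F ^+ m.+1) w = 0].
Proof.
elim: n v => [|n IH] v v0 Ev; first by rewrite act1 => vE; rewrite vE eqxx in v0.
move=> Fv; have := E_act_Fn n Ev; rewrite Fv linear0 => /esym/eqP.
rewrite scaler_eq0 subr_eq0 -(inj_eq (mulfI Q_neq0)) mulfV // -exprS eq_sym.
rewrite (negbTE (Q_nru _)) //= => /eqP Fv'.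
set v' := v - _ in Fv'; have [v'0|v'_neq0] := eqVneq v' 0; last first.
  apply: (IH v') => //.
  have := congr1 (fun a => act a v) EK.
  by rewrite /v' linearB linearZ /= Ev actM actZ actM Ev linear0 => ->;
    rewrite !scaler0 subr0.
exists n, v; split=> //; apply: (scalerI (expf_neq0 n Q_neq0)).
rewrite scalerA mulfV ?expf_neq0 // scale1r; apply/eqP.
by rewrite eq_sym -subr_eq0 -/v' v'0.
Qed.

Lemma highest_weight_exists : (fullv : {vspace N}) <> 0%VS ->
  exists m (w : N), [/\ w != 0, act E w = 0, act k w = Q ^- m *: w &
    act (F ^+ m.+1) w = 0].
Proof.
move=> /eqP N0; have [e Ee] := E_act_nilpotent; have [f Ff] := F_act_nilpotent.
have v0 : vpick (fullv : {vspace N}) != 0 by rewrite vpick0.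
have [|w w0 Ew] := @nilpotent_kernel _ _ N E e _ v0.
  exact: Ee.
exact: (@highest_weight_from f w).
Qed.

End WeightTheory.

(** For x^2, xz and z^2 the identity f (a v) = a (f v) is checked after applying k,
    where both sides become the action of a polynomial in E and F. *)
Lemma even_intertwiner (K : fieldType) (q : K) (q_neq0 : q != 0)
    (q_nru : not_root_of_unity q) (M N : fdmodule (even_subalg q_neq0 q_nru))
    (f : 'Hom(M, N)) :
    (forall v, f (act (evE q_neq0 q_nru) v) = act (evE q_neq0 q_nru) (f v)) ->
    (forall v, f (act (evF q_neq0 q_nru) v) = act (evF q_neq0 q_nru) (f v)) ->
    (forall v, f (act (evK q_neq0 q_nru) v) = act (evK q_neq0 q_nru) (f v)) ->
  forall a v, f (act a v) = act a (f v).
Proof.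
move=> fE fF fK.
pose P a := forall v, f (act a v) = act a (f v).
have P1 : P 1 by move=> v; rewrite !act1.
have PM a b : P a -> P b -> P (a * b) by move=> Pa Pb v; rewrite !actM Pa Pb.
have PL c a b : P a -> P b -> P (c *: a + b).
  by move=> Pa Pb v; rewrite !(actD, actZ) linearD linearZ /= Pa Pb.
have PB c a : P a -> P (1 - c *: a).
  by move=> Pa; rewrite addrC -scaleNr; apply: (PL).
have PB1 a : P a -> P (1 - a) by move=> /(PB 1); rewrite scale1r.
have kI := k_act_inj (expf_neq0 2 q_neq0) (nru_pow (isT : 0 < 2)%N q_nru)
  (ev_EK q_neq0 q_nru) (ev_Z2E q_neq0 q_nru) (ev_Z2K q_neq0 q_nru) (ev_KZ2 q_neq0 q_nru).
have PK a b : evK q_neq0 q_nru * a = b -> P b -> P a.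
  move=> ab Pb v; apply: (kI N).
  by rewrite -fK -!actM ab Pb.
apply: even_subalg_ind => //.
- by apply: (PK _ _ (ev_KX2 _ _)); apply: (PM); apply: (PB).
- by have := PB1 _ fF; rewrite subKr.
- by apply: (PK _ _ (ev_KXZ _ _)); apply: (PM); [apply: (PB)|apply: (PB1)].
- by have := PB1 _ fE; rewrite subKr.
- by apply: (PK _ _ (ev_KZ2 _ _)); apply: (PM); [apply: (PB1)|apply: (PB)].
Qed.

(** * From Chevalley-type to equitable generators *)

Section EquitableFromChevalley.
Variables (K : fieldType) (Q : K) (B : algType K) (Y Yi E F : B).
Hypotheses (Q_neq0 : Q != 0) (YYi : Y * Yi = 1) (YiY : Yi * Y = 1).
Hypothesis EY : E * Y = Q *: (Y * E).
Hypothesis YF : Y * F = Q *: (F * Y).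
Hypothesis EF : E * F = Q *: (F * E) + (Q^-1 - 1) *: (1 - Y ^+ 2).
Local Notation x := ((1 - F) * Yi).
Local Notation z := (Yi * (1 - E)).

Let xy : x * Y = 1 - F. Proof. by rewrite -mulrA YiY mulr1. Qed.
Let yz : Y * z = 1 - E. Proof. by rewrite mulrA YYi mul1r. Qed.
Let yx : Y * x = 1 - Q *: F.
Proof. by rewrite mulrA mulrBr mulr1 YF mulrBl YYi -scalerAl -mulrA YYi mulr1. Qed.
Let zy : z * Y = 1 - Q *: E.
Proof. by rewrite -mulrA mulrBl mul1r EY mulrBr YiY -scalerAr mulrA YiY mul1r. Qed.

Lemma chevalley_yx : Y * x = Q *: (x * Y) + (1 - Q) *: 1.
Proof. by rewrite yx xy scalerBr scalerBl scale1r [RHS]addrC subrKA. Qed.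

Lemma chevalley_zy : z * Y = Q *: (Y * z) + (1 - Q) *: 1.
Proof. by rewrite zy yz scalerBr scalerBl scale1r [RHS]addrC subrKA. Qed.

(** Multiplying by Y on both sides separates the inner pairs: Y (x z) Y is
    (Y x)(z Y) and Y (z x) Y is (Y z)(x Y), all polynomials in E and F. *)
Lemma chevalley_xz : x * z = Q *: (z * x) + (1 - Q) *: 1.
Proof.
have cancelY : injective (fun w => Y * w * Y).
  apply: (can_inj (g := fun w => Yi * w * Yi)) => w /=.
  by rewrite !mulrA YiY mul1r -mulrA YYi mulr1.
apply: cancelY => /=.
have -> : Y * (Q *: (z * x) + (1 - Q) *: 1) * Y =
    Q *: (Y * (z * x) * Y) + (1 - Q) *: Y ^+ 2.
  by rewrite [Y * _]mulrDr mulrDl -!scalerAr -!scalerAl mulr1.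
have -> : Y * (x * z) * Y = (Y * x) * (z * Y) by rewrite !mulrA.
have -> : Y * (z * x) * Y = (Y * z) * (x * Y) by rewrite !mulrA.
rewrite yx zy yz xy.
have QFE : Q *: (Q *: (F * E)) = Q *: (E * F) - (1 - Q) *: (1 - Y ^+ 2).
  by rewrite EF scalerDr (scalerA Q (Q^-1 - 1)) mulrBr mulfV // mulr1 addrK.
rewrite mulrBl mul1r [Q *: F * _]mulrBr mulr1 -scalerAr -scalerAl QFE.
rewrite [(1 - E) * _]mulrBl mul1r [E * (1 - F)]mulrBr mulr1.
move: (E * F) (Y ^+ 2) => g k2.
rewrite !scalerBr !opprB !scalerBl !scale1r opprB !addrA.
by rewrite [LHS](ACl (1*7*6*8*3*2*4*5))/= subrr add0r.
Qed.

End EquitableFromChevalley.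

(** * The explicit module of dimension d + 1 *)

Section Model.
Variables (K : fieldType) (q : K) (q_neq0 : q != 0) (q_nru : not_root_of_unity q).
Variable d : nat.
Local Notation A := (even_subalg q_neq0 q_nru).
Local Notation Q := (q ^+ 2).
Let Q_neq0 : Q != 0. Proof. exact: expf_neq0. Qed.
Let Q_nru : not_root_of_unity Q. Proof. exact: nru_pow. Qed.

(** The basis vectors are indexed by all natural numbers, with value 0 beyond d;
    the formulas for the operators then hold for every index. *)
Definition vb (n : nat) : 'cV[K]_d.+1 := \col_i (i == n :> nat)%:R.

Lemma vb_gt n : (d < n)%N -> vb n = 0.
Proof.
move=> h; apply/colP => i; rewrite !mxE; case: eqP => // ein.
by move: (ltn_ord i); rewrite ein ltnS leqNgt h.
Qed.

Lemma vb_sum (u : 'cV[K]_d.+1) : u = \sum_i u i 0 *: vb i.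
Proof.
apply/colP => j; rewrite summxE (bigD1 j) //= !mxE eqxx mulr1 big1 ?addr0 // => i.
by rewrite !mxE eq_sym -val_eqE /= => /negbTE ->; rewrite mulr0.
Qed.

Definition colmx (g : nat -> 'cV[K]_d.+1) : 'M[K]_d.+1 := \matrix_(i, j) g j i 0.

Lemma colmx_vb g n : (n <= d)%N -> colmx g *m vb n = g n.
Proof.
move=> h; apply/colP => i; rewrite mxE (bigD1 (Ordinal (h : (n < d.+1)%N))) //=.
rewrite !mxE /= eqxx mulr1 big1 ?addr0 // => j.
by rewrite !mxE -val_eqE /= => /negbTE ->; rewrite mulr0.
Qed.

Lemma mx_ext (X Y : 'M[K]_d.+1) : (forall n, X *m vb n = Y *m vb n) -> X = Y.
Proof.
move=> XY; apply/matrixP => i j; have /colP/(_ i) := XY j; rewrite !mxE.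
rewrite (bigD1 j) //= big1 ?addr0 => [|k]; last first.
  by rewrite mxE -val_eqE /= => /negbTE ->; rewrite mulr0.
rewrite (bigD1 j) //= big1 ?addr0 => [|k]; last first.
  by rewrite mxE -val_eqE /= => /negbTE ->; rewrite mulr0.
by rewrite !mxE eqxx !mulr1.
Qed.

(** Eigenvalues of y, namely q^(2n - d); those of k = y^2 are their squares. *)
Definition wt n : K := Q ^+ n / q ^+ d.
(** The coefficient forced by [E_past_Fn] on a highest weight vector of k-weight
    Q^-d.  It vanishes at n = d, in accordance with [vb d.+1] being 0. *)
Definition ecoef n : K := (Q^-1 - Q ^+ n) * (1 - Q ^+ n / Q ^+ d).

Lemma wt_neq0 n : wt n != 0.
Proof. by rewrite mulf_neq0 ?invr_neq0 ?expf_neq0. Qed.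

Definition mY := colmx (fun n => wt n *: vb n).
Definition mYi := colmx (fun n => (wt n)^-1 *: vb n).
Definition mF := colmx (fun n => vb n.+1).
Definition mE := colmx (fun n => if n is p.+1 then ecoef p *: vb p else 0).

Lemma mY_vb n : mY *m vb n = wt n *: vb n.
Proof.
have [h|h] := leqP n d; first by rewrite colmx_vb.
by rewrite vb_gt // mulmx0 scaler0.
Qed.

Lemma mYi_vb n : mYi *m vb n = (wt n)^-1 *: vb n.
Proof.
have [h|h] := leqP n d; first by rewrite colmx_vb.
by rewrite vb_gt // mulmx0 scaler0.
Qed.

Lemma mF_vb n : mF *m vb n = vb n.+1.
Proof.
have [h|h] := leqP n d; first by rewrite colmx_vb.
by rewrite !vb_gt ?mulmx0 // ltnW.
Qed.

Lemma mE_vb0 : mE *m vb 0 = 0.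
Proof. by rewrite colmx_vb. Qed.

Lemma mE_vb n : mE *m vb n.+1 = ecoef n *: vb n.
Proof.
have [h|h] := ltnP n d; first by rewrite colmx_vb.
rewrite vb_gt // mulmx0; move: h; rewrite leq_eqVlt => /predU1P [<-|h].
  by rewrite /ecoef mulfV ?expf_neq0 // subrr mulr0 scale0r.
by rewrite vb_gt // scaler0.
Qed.

Lemma mYYi : mY * mYi = 1.
Proof.
apply: mx_ext => n; rewrite -mulmxA mYi_vb -scalemxAr mY_vb scalerA mulVf ?wt_neq0 //.
by rewrite scale1r mul1mx.
Qed.

Lemma mYiY : mYi * mY = 1.
Proof.
apply: mx_ext => n; rewrite -mulmxA mY_vb -scalemxAr mYi_vb scalerA mulfV ?wt_neq0 //.
by rewrite scale1r mul1mx.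
Qed.

Lemma wtS n : wt n.+1 = Q * wt n.
Proof. by rewrite /wt exprS mulrA. Qed.

Lemma mEY : mE * mY = Q *: (mY * mE).
Proof.
apply: mx_ext => -[|n]; rewrite -scalemxAl -!mulmxA !mY_vb -?scalemxAr.
  by rewrite mE_vb0 mulmx0 !scaler0.
by rewrite !mE_vb -scalemxAr mY_vb !scalerA wtS; congr (_ *: _); ring.
Qed.

Lemma mYF : mY * mF = Q *: (mF * mY).
Proof.
apply: mx_ext => n; rewrite -scalemxAl -!mulmxA !mY_vb -?scalemxAr mF_vb mY_vb.
by rewrite scalerA wtS.
Qed.

Lemma mEF : mE * mF = Q *: (mF * mE) + (Q^-1 - 1) *: (1 - mY ^+ 2).
Proof.
apply: mx_ext => n.
rewrite mulmxDl -!scalemxAl mulmxBl mul1mx (expr2 mY) -!mulmxA.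
rewrite mY_vb -scalemxAr mY_vb mF_vb mE_vb.
have wt2 : wt n * wt n = (Q ^+ n) ^+ 2 / Q ^+ d.
  by rewrite /wt mulf_div -!expr2 -!exprM (mulnC d).
(* The right-hand side is Q * ecoef (n - 1), continued to n = 0, where it vanishes. *)
have -> : Q *: (mF *m (mE *m vb n)) =
    (Q * (Q^-1 - Q ^+ n / Q) * (1 - Q ^+ n / Q / Q ^+ d)) *: vb n.
  case: n {wt2} => [|n].
    by rewrite mE_vb0 mulmx0 scaler0 expr0 mul1r subrr mulr0 mul0r scale0r.
  rewrite mE_vb -scalemxAr mF_vb scalerA /ecoef (exprS Q n); congr (_ *: _).
  move: (expf_neq0 d Q_neq0) Q_neq0; move: (Q ^+ n) (Q ^+ d) => s t t0; move: Q => r r0.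
  by field; rewrite r0 t0.
rewrite scalerBr !scalerA -scalerBl -scalerDl -(mulrA _ (wt n)) wt2 /ecoef.
congr (_ *: _).
move: (expf_neq0 d Q_neq0) Q_neq0; move: (Q ^+ n) (Q ^+ d) => s t t0; move: Q => r r0.
by field; rewrite r0 t0.
Qed.

(** The values of x and z are forced by x y = 1 - F and y z = 1 - E. *)
Definition model_gen (i : Uq_gen) : 'M[K]_d.+1 := match i with
  | gen_x => (1 - mF) * mYi | gen_y => mY | gen_yinv => mYi | gen_z => mYi * (1 - mE)
  end.

Lemma eval_tqcomm (B : algType K) (g : Uq_gen -> B) (i j : Uq_gen) :
  g j * g i = Q *: (g i * g j) + (1 - Q) *: 1 ->
  Uq_eval g (tqcomm q (tGen i) (tGen j)) = 1%:A.
Proof.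
move=> ji; rewrite /= ji !mulr_algl scaleN1r (scalerDr q^-1) !scalerA.
rewrite expr2 mulrA mulVf // mul1r opprD addNKr -scaleNr scalerA; congr (_ *: _).
rewrite -[RHS](mulVf (subr_inv_neq0 q_neq0 q_nru)); congr (_ * _).
by rewrite mulrBr mulr1 opprB mulrA mulVf // mul1r.
Qed.

Lemma model_rel t u : Uq_rel q t u -> Uq_eval model_gen t = Uq_eval model_gen u.
Proof.
case.
- by rewrite /= mYYi scale1r.
- by rewrite /= mYiY scale1r.
- exact/eval_tqcomm/(chevalley_yx mYYi mYiY mYF).
- exact/eval_tqcomm/(chevalley_zy mYYi mYiY mEY).
- exact/eval_tqcomm/(chevalley_xz Q_neq0 mYYi mYiY mEY mYF mEF).
Qed.

Definition model_mx (a : A) : 'M[K]_d.+1 := Uq_lift model_gen (even_val a).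

Lemma model_mx_linear : linear model_mx.
Proof.
have [lin _ _] := Uq_lift_morph q_neq0 q_nru model_rel.
by move=> c a b; rewrite /model_mx -lin.
Qed.

HB.instance Definition _ := GRing.isLinear.Build K A 'M[K]_d.+1 _ model_mx
  model_mx_linear.

Lemma model_mx1 : model_mx 1 = 1.
Proof.
by have [_ one _] := Uq_lift_morph q_neq0 q_nru model_rel.
Qed.

Lemma model_mxM a b : model_mx (a * b) = model_mx a * model_mx b.
Proof.
have [_ _ mul] := Uq_lift_morph q_neq0 q_nru model_rel.
exact: mul.
Qed.

Definition model_act (a : A) : 'End('cV[K]_d.+1) := linfun (mulmx (model_mx a)).

Lemma model_act_linear : linear model_act.
Proof.
move=> c a b; apply/lfunP => u; rewrite add_lfunE scale_lfunE !lfunE /=.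
by rewrite linearP mulmxDl scalemxAl.
Qed.

HB.instance Definition _ := GRing.isLinear.Build K A 'End('cV[K]_d.+1) _ model_act
  model_act_linear.

Lemma model_act1 : model_act 1 = \1%VF.
Proof. by apply/lfunP => u; rewrite lfunE /= id_lfunE model_mx1 mul1mx. Qed.

Lemma model_actM a b : model_act (a * b) = (model_act a \o model_act b)%VF.
Proof. by apply/lfunP => u; rewrite comp_lfunE !lfunE /= model_mxM mulmxA. Qed.

Definition model : fdmodule A :=
  @FDModule K A 'cV[K]_d.+1 model_act model_act1 model_actM.

Lemma model_actE (a : A) (u : model) : act a u = model_mx a *m u.
Proof. by rewrite /act lfunE. Qed.

Let lift_gen i : Uq_lift model_gen (Uq_class q_neq0 q_nru (tGen i)) = model_gen i.
Proof. exact: (Uq_liftE q_neq0 q_nru model_rel). Qed.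

Let lift_mul (u v : Uq q_neq0 q_nru) : Uq_lift model_gen (u * v) =
  Uq_lift model_gen u * Uq_lift model_gen v :> 'M[K]_d.+1.
Proof.
have [_ _ mul] := Uq_lift_morph q_neq0 q_nru model_rel.
exact: mul.
Qed.

Lemma model_K : model_mx (evK _ _) = mY ^+ 2.
Proof. by rewrite /model_mx lift_mul !lift_gen -expr2. Qed.

Lemma model_E : model_mx (evE _ _) = mE.
Proof.
rewrite linearB /= model_mx1 /model_mx lift_mul !lift_gen /=.
by rewrite mulrA mYYi mul1r subKr.
Qed.

Lemma model_F : model_mx (evF _ _) = mF.
Proof.
rewrite linearB /= model_mx1 /model_mx lift_mul !lift_gen /=.
by rewrite -mulrA mYiY mulr1 subKr.
Qed.

Lemma model_dim : \dim (fullv : {vspace model}) = d.+1.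
Proof. by rewrite dimvf /dim /= muln1. Qed.

Lemma ecoef_neq0 n : (n < d)%N -> ecoef n != 0.
Proof.
move=> lt; rewrite mulf_neq0 // subr_eq0.
  rewrite -(inj_eq (mulfI Q_neq0)) mulfV // -exprS eq_sym; exact: Q_nru.
rewrite eq_sym -(inj_eq (mulIf (expf_neq0 d Q_neq0))) mulfVK ?expf_neq0 // mul1r.
by rewrite (inj_eq (nru_expr_inj Q_neq0 Q_nru)) neq_ltn lt.
Qed.

Lemma mE_coef (u : 'cV[K]_d.+1) (i j : 'I_d.+1) :
  j = i.+1 :> nat -> (mE *m u) i 0 = ecoef i * u j 0.
Proof.
move=> ji; rewrite mxE (bigD1 j) //= !mxE ji big1 ?addr0 => [|k kj].
  by rewrite !mxE eqxx mulr1.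
rewrite !mxE; case E : (k : nat) => [|p]; first by rewrite mxE mul0r.
rewrite !mxE; case: eqP => [ip|_]; last by rewrite mulr0 mul0r.
by case/eqP: kj; apply/val_inj; rewrite /= ji E ip.
Qed.

Lemma mE_coef_max (u : 'cV[K]_d.+1) : (mE *m u) ord_max 0 = 0.
Proof.
rewrite mxE big1 // => k _; rewrite !mxE.
case E : (k : nat) => [|p]; first by rewrite mxE mul0r.
rewrite !mxE; case: eqP => [/= ip|_]; last by rewrite mulr0 mul0r.
by have := ltn_ord k; rewrite E -ip ltnn.
Qed.

(** Applying E lowers the largest index occurring in a vector by exactly one, since
    [ecoef] has no zero below d.  So a nonzero submodule contains the first basis
    vector, and F carries that vector to all the others. *)
Lemma model_irreducible : irreducible model.
Proof.
split=> [V0|W Wsub].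
  by have := model_dim; rewrite V0 dimv0.
have [->|W0] := eqVneq W 0%VS; [by left | right].
have WA a (u : model) : u \in W -> act a u \in W.
  by move=> uW; apply: (subvP (Wsub a)); apply: memv_img.
have WE u : u \in W -> mE *m u \in W.
  by move=> /(WA (evE _ _)); rewrite model_actE model_E.
have WF u : u \in W -> mF *m u \in W.
  by move=> /(WA (evF _ _)); rewrite model_actE model_F.
have v0_reached m (u : model) : u \in W -> u != 0 ->
    (forall i : 'I_d.+1, (m < i)%N -> (u : 'cV[K]_d.+1) i 0 = 0) -> (vb 0 : model) \in W.
  elim: m u => [|m IH] u uW u0 um.
    have uE : u = (u : 'cV[K]_d.+1) 0 0 *: vb 0.
      rewrite {1}(vb_sum u) (bigD1 0) //= big1 ?addr0 // => i i0.
      by rewrite um ?scale0r // lt0n.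
    have c0 : (u : 'cV[K]_d.+1) 0 0 != 0.
      by apply: contraNneq u0 => c0; rewrite uE c0 scale0r.
    by have := memvZ ((u : 'cV[K]_d.+1) 0 0)^-1 uW; rewrite {2}uE scalerK.
  have [lt|ge] := ltnP m d; last first.
    apply: (IH u) => // i im; have := leq_ltn_trans ge im.
    by rewrite ltnNge -ltnS ltn_ord.
  pose j : 'I_d.+1 := Ordinal (lt : m.+1 < d.+1)%N.
  have [uj|uj] := eqVneq ((u : 'cV[K]_d.+1) j 0) 0.
    apply: (IH u) => // i; rewrite leq_eqVlt => /predU1P [im|/um //].
    by rewrite (_ : i = j) //; apply/val_inj.
  apply: (IH (mE *m u)); first exact: WE.
    apply: contraNneq uj => /colP /(_ (Ordinal (ltnW lt : m < d.+1)%N)).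
    rewrite (@mE_coef _ _ j) // mxE => /eqP.
    by rewrite mulf_eq0 (negbTE (ecoef_neq0 lt)).
  move=> i mi; have [lid|ge] := ltnP i d.
    by rewrite (@mE_coef _ _ (Ordinal (lid : i.+1 < d.+1)%N)) // um ?mulr0 //=.
  have -> : i = ord_max by apply/val_inj/eqP; rewrite /= eqn_leq ge -ltnS ltn_ord.
  exact: mE_coef_max.
have v0W : (vb 0 : model) \in W.
  apply: (@v0_reached d (vpick W)); rewrite ?memv_pick ?vpick0 // => i.
  by rewrite ltnNge -ltnS ltn_ord.
have vW n : (vb n : model) \in W.
  by elim: n => // n /WF; rewrite mF_vb.
apply/eqP; rewrite eqEsubv subvf; apply/subvP => u _.
by rewrite [u]vb_sum; apply: memv_suml => i _; apply/memvZ/vW.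
Qed.

(** The map sends the basis vector of index n to F^n w.  It commutes with E by
    [E_past_Fn], with F because F^(d+1) w = 0, and with k because F shifts weights
    by Q^2. *)
Lemma model_from_highest_weight (N : fdmodule A) (w : N) :
    w != 0 -> act (evE q_neq0 q_nru) w = 0 ->
    act (evK q_neq0 q_nru) w = Q ^- d *: w ->
    act (evF q_neq0 q_nru ^+ d.+1) w = 0 ->
  exists2 f : 'Hom(model, N), f != 0 &
    forall a v, f (act a v) = act a (f v).
Proof.
move=> w0 Ew Kw Fw; pose F := evF q_neq0 q_nru.
pose phi (u : model) := \sum_(i < d.+1) (u : 'cV[K]_d.+1) i 0 *: act (F ^+ i) w.
have phi_lin : linear phi.
  move=> c u v; rewrite scaler_sumr -big_split; apply: eq_bigr => i _ /=.
  by rewrite !mxE scalerDl scalerA.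
pose f : {linear model -> N} := HB.pack phi (GRing.isLinear.Build K model N _ _ phi_lin).
have Fgt n : (d < n)%N -> act (F ^+ n) w = 0.
  by move=> lt; rewrite -(subnK lt) exprD actM Fw linear0.
have fvb n : linfun f (vb n : model) = act (F ^+ n) w.
  rewrite lfunE /= /phi; have [le|lt] := leqP n d; last first.
    by rewrite Fgt // big1 // => i _; rewrite vb_gt // mxE scale0r.
  rewrite (bigD1 (Ordinal (le : n < d.+1)%N)) //= big1 ?addr0 => [|i].
    by rewrite mxE eqxx scale1r.
  by rewrite -val_eqE mxE /= => /negbTE ->; rewrite scale0r.
have KF n : act (evK q_neq0 q_nru) (act (F ^+ n) w) = (wt n) ^+ 2 *: act (F ^+ n) w.
  rewrite -actM (qcommute_exprr n (ev_KF q_neq0 q_nru)) actZ actM Kw linearZ /=.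
  rewrite scalerA /wt expr_div_n -!exprM; congr (_ * _^-1 *: _).
    by congr (_ ^+ _); lia.
  by congr (_ ^+ _); lia.
have on_basis a :
    (forall n, linfun f (act a (vb n : model)) = act a (linfun f (vb n : model))) ->
    forall v, linfun f (act a v) = act a (linfun f v).
  move=> fa v; rewrite [v]vb_sum !linear_sum; apply: eq_bigr => i _ /=.
  by rewrite !linearZ /= fa.
exists (linfun f).
  by apply: contraNneq w0 => f0; have := fvb 0; rewrite f0 zero_lfunE act1 => <-.
apply: even_intertwiner; apply: on_basis => n; rewrite fvb model_actE.
- rewrite model_E; case: n => [|n].
    by rewrite mE_vb0 linear0 act1 Ew.
  rewrite mE_vb linearZ /= fvb (E_act_Fn Q_neq0 (ev_KF _ _) (ev_EF _ _) _ Ew) Kw.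
  by rewrite scalerA -[X in act _ (X - _)]scale1r -scalerBl linearZ /= scalerA.
- by rewrite model_F mF_vb fvb act_exprS.
- rewrite model_K -[mY ^+ 2 *m _]mulmxA mY_vb -scalemxAr mY_vb scalerA linearZ /=.
  by rewrite fvb KF.
Qed.

End Model.

Theorem corollary8p10 (K : fieldType) (q : K) (q_neq0 : q != 0)
    (q_nru : not_root_of_unity q) (d : nat) :
  exists M : fdmodule (even_subalg q_neq0 q_nru),
    [/\ irreducible M, \dim (fullv : {vspace M}) = d.+1 &
      forall N : fdmodule (even_subalg q_neq0 q_nru),
        irreducible N -> \dim (fullv : {vspace N}) = d.+1 -> fdm_iso N M].
Proof.
exists (model q_neq0 q_nru d); split; [exact: model_irreducible|exact: model_dim|].
move=> N irrN dimN.
have [m [w [w0 Ew Kw Fw]]] := highest_weight_exists (N := N) (expf_neq0 2 q_neq0)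
  (nru_pow (isT : 0 < 2)%N q_nru) (ev_EK _ _) (ev_KF _ _) (ev_EF _ _) (ev_Z2E _ _)
  (ev_Z2K _ _) (ev_KZ2 _ _) (proj1 irrN).
have [f f0 fA] := model_from_highest_weight w0 Ew Kw Fw.
have [iso] := schur (model_irreducible q_neq0 q_nru m) irrN f0 fA.
by rewrite model_dim dimN => -[<-].
Qed.
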